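(* Let $0<\beta<1$, $0\le\alpha\le1$, let $T\ge 2$ be an integer, let $\kappa=(1-\beta)(1-\alpha\beta)(1-\alpha^2\beta)$, let $K_{DC2}$ be the $T\times T$ DC2 kernel matrix with hyperparameters $\alpha,\beta$, and let $L$ denote the Cholesky factor of $K_{DC2}^{-1}$ (so $L$ is lower triangular with positive diagonal and $K_{DC2}^{-1}=LL^\top$). Then $$[L]_{t,s}=\begin{cases}\dfrac{1}{\sqrt{\kappa\beta^t}}, & 1\le t=s\le T-2,\\[2mm] \dfrac{-(1+\alpha)}{\sqrt{\kappa\beta^{t-1}}}, & 2\le t=s+1\le T-1,\\[2mm] \dfrac{\alpha}{\sqrt{\kappa\beta^{t-2}}}, & 3\le t=s+2\le T,\\[2mm] \sqrt{\dfrac{(1+\alpha\beta)\beta^{-T+1}}{(1-\beta)(1-\alpha^2\beta)}}, & t=s=T-1,\\[2mm] \dfrac{-(1+\alpha)\sqrt{\beta^{-T+1}}}{\sqrt{(1+\alpha\beta)(1-\beta)(1-\alpha^2\beta)}}, & t=s+1=T,\\[2mm] \sqrt{\dfrac{\beta^{-T}}{1+\alpha\beta}}, & t=s=T,\\[2mm] 0, & \text{otherwise.}\end{cases}$$ Moreover, $$\det K_{DC2}=\beta^{\frac{T(T+1)}{2}}(1-\alpha\beta)^{T-2}(1-\beta)^{T-1}(1-\alpha^2\beta)^{T-1}.$$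
   Context: Let $0<\beta<1$ and $0\le\alpha\le1$. Let $\mathcal{F}$ be the infinite (indexed by $t,s\ge 1$) lower triangular Toeplitz matrix with first column $(1,-1,0,0,\ldots)^\top$, $\mathcal{D}=\mathrm{diag}(\beta^{-1},\beta^{-2},\ldots,\beta^{-t},\ldots)$, and $\mathcal{F}_{2,\alpha}=(1-\alpha)\mathcal{F}+\alpha\mathcal{F}^2$. The (infinite) DC2 kernel is $\mathcal{K}_{DC2}=\kappa(\mathcal{F}_{2,\alpha}\mathcal{D}\mathcal{F}_{2,\alpha}^\top)^{-1}$ with $\kappa=(1-\beta)(1-\alpha\beta)(1-\alpha^2\beta)$, where the inverse is understood as $(\mathcal{F}_{2,\alpha}^{-1})^\top\mathcal{D}^{-1}\mathcal{F}_{2,\alpha}^{-1}$, with $\mathcal{F}_{2,\alpha}^{-1}$ the lower triangular Toeplitz inverse of $\mathcal{F}_{2,\alpha}$, and entries of products of infinite matrices are (convergent) series. The $T\times T$ kernel matrix $K_{DC2}$ is defined by $[K_{DC2}]_{t,s}=[\mathcal{K}_{DC2}]_{t,s}$ for $t,s=1,\ldots,T$. *)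

(* Defs.v *)
From HB Require Import structures.
From mathcomp Require Import all_boot all_order all_algebra.
From mathcomp Require Import ring lra zify.
From mathcomp Require Import all_classical all_reals all_analysis.
Import Order.TTheory GRing.Theory Num.Theory.
Import numFieldNormedType.Exports.

Set Implicit Arguments.
Unset Strict Implicit.
Unset Printing Implicit Defensive.

Local Open Scope classical_set_scope.
Local Open Scope ring_scope.

(* Infinite matrices.  Rows and columns are numbered from 0, so the mathematical
   entry [A]_{t,s} with t, s >= 1 is [A t.-1 s.-1]. *)
Definition imx (R : realType) := nat -> nat -> R.

Section InfiniteMatrices.
Context {R : realType}.
Implicit Types (A B : imx R) (c d : nat -> R).

(* [limn] is total: the value is meaningful only when the series converges,
   which [DC2_F_sqr_cvg], [DC2_F2inv_spec] and [DC2_kernel_cvg] below establish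
   for the products that are used. *)
Definition imx_mul A B : imx R :=
  fun i j => limn (fun n => \sum_(0 <= k < n) A i k * B k j).

Definition imx_cvg_mul A B :=
  forall i j, cvgn (fun n => \sum_(0 <= k < n) A i k * B k j).

Definition imx_tr A : imx R := fun i j => A j i.

Definition imx_diag d : imx R := fun i j => if i == j then d i else 0.

Definition imx1 : imx R := imx_diag (fun=> 1).

Definition lt_toeplitz c : imx R := fun i j => if (j <= i)%N then c (i - j)%N else 0.

Definition is_lt_toeplitz_inv A B :=
  [/\ exists c, B = lt_toeplitz c,
      imx_cvg_mul A B /\ imx_mul A B = imx1 &
      imx_cvg_mul B A /\ imx_mul B A = imx1].

Definition lt_toeplitz_inv A : imx R := get [set B | is_lt_toeplitz_inv A B].

End InfiniteMatrices.

Section DC2.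
Context {R : realType}.
Variables alpha beta : R.

Definition DC2_F : imx R := lt_toeplitz (nth 0 [:: 1; -1]).

Definition DC2_F2 : imx R := fun i j =>
  (1 - alpha) * DC2_F i j + alpha * imx_mul DC2_F DC2_F i j.

Definition DC2_D : imx R := imx_diag (fun i => beta ^- i.+1).

Definition DC2_Dinv : imx R := imx_diag (fun i => (DC2_D i i)^-1).

Definition DC2_kappa : R :=
  (1 - beta) * (1 - alpha * beta) * (1 - alpha ^+ 2 * beta).

Definition DC2_F2inv : imx R := lt_toeplitz_inv DC2_F2.

Definition DC2_kernel : imx R := fun t s =>
  DC2_kappa * imx_mul (imx_mul (imx_tr DC2_F2inv) DC2_Dinv) DC2_F2inv t s.

Definition DC2_kernel_mx (T : nat) : 'M[R]_T :=
  \matrix_(t < T, s < T) DC2_kernel t s.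

(* Here t and s are the 1-based row and column numbers. *)
Definition DC2_chol_entry (T t s : nat) : R :=
  if (1 <= t)%N && (t == s) && (s <= T - 2)%N then
    1 / Num.sqrt (DC2_kappa * beta ^+ t)
  else if (2 <= t)%N && (t == s + 1)%N && (s + 1 <= T - 1)%N then
    - (1 + alpha) / Num.sqrt (DC2_kappa * beta ^+ (t - 1))
  else if (3 <= t)%N && (t == s + 2)%N && (s + 2 <= T)%N then
    alpha / Num.sqrt (DC2_kappa * beta ^+ (t - 2))
  else if (t == s) && (s == T - 1)%N then
    Num.sqrt ((1 + alpha * beta) * beta ^- (T - 1)
              / ((1 - beta) * (1 - alpha ^+ 2 * beta)))
  else if (t == s + 1)%N && (s + 1 == T)%N then
    - (1 + alpha) * Num.sqrt (beta ^- (T - 1))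
    / Num.sqrt ((1 + alpha * beta) * (1 - beta) * (1 - alpha ^+ 2 * beta))
  else if (t == s) && (s == T) then
    Num.sqrt (beta ^- T / (1 + alpha * beta))
  else 0.

End DC2.

Definition is_cholesky_factor (R : realType) (n : nat) (A L : 'M[R]_n) :=
  [/\ forall i j : 'I_n, (i < j)%N -> L i j = 0,
      forall i : 'I_n, 0 < L i i &
      A = L *m L^T].

(* Well-definedness: the inverse of [DC2_F2] exists and is unique, and all the
   series defining the kernel converge. *)
Section WellDefined.
Context {R : realType}.
Implicit Types (A B : imx R) (c d : nat -> R).

Let cvg_fin A B i j N : (forall k, (N <= k)%N -> A i k * B k j = 0) ->
  (fun n => \sum_(0 <= k < n) A i k * B k j) @ \oo
    --> \sum_(0 <= k < N) A i k * B k j.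
Proof.
move=> H; apply: cvg_near_cst; near=> n.
have Nn : (N <= n)%N by near: n; exists N.
rewrite (@big_cat_nat _ _ _ N 0 n) //= [X in _ + X]big_nat_cond [X in _ + X]big1 ?addr0 //.
by move=> k /andP[/andP[Nk _] _]; exact: H.
Unshelve. all: by end_near. Qed.

Let lt_cvg_fin c B i j :
  (fun n => \sum_(0 <= k < n) lt_toeplitz c i k * B k j) @ \oo
    --> \sum_(0 <= k < i.+1) lt_toeplitz c i k * B k j.
Proof.
by apply: cvg_fin => k ik; rewrite /lt_toeplitz leqNgt ik /= mul0r.
Qed.

Let conv c d n := \sum_(0 <= m < n.+1) c (n - m)%N * d m.

Let convC c d n : conv c d n = conv d c n.
Proof.
rewrite /conv big_nat_rev /= big_nat_cond [RHS]big_nat_cond.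
apply: eq_bigr => m /andP[/andP[_ mn] _].
by rewrite mulrC add0n subSS subKn.
Qed.

Lemma lt_toeplitz_mul c d :
  imx_mul (lt_toeplitz c) (lt_toeplitz d) =
  lt_toeplitz (fun n => \sum_(0 <= m < n.+1) c (n - m)%N * d m).
Proof.
apply/funext => i; apply/funext => j; rewrite /imx_mul (cvg_lim _ (@lt_cvg_fin _ _ _ _)) //.
rewrite [RHS]/lt_toeplitz; case: leqP => ji; last first.
  rewrite big_nat_cond big1 // => k /andP[/andP[_ ki] _].
  by rewrite /lt_toeplitz [(j <= k)%N]leqNgt (leq_trans ki ji) /= mulr0.
rewrite (@big_cat_nat _ _ _ j) //=; last exact: leqW.
rewrite [X in X + _]big_nat_cond big1 ?add0r; last first.
  by move=> k /andP[/andP[_ kj] _]; rewrite /lt_toeplitz [(j <= k)%N]leqNgt kj /= mulr0.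
rewrite -{1}[j]add0n big_addn subSn // big_nat_cond [RHS]big_nat_cond.
apply: eq_bigr => k /andP[/andP[_ ki] _].
rewrite /lt_toeplitz leq_addl addnK.
have -> : (k + j <= i)%N by lia.
by congr (c _ * _); lia.
Qed.

Lemma DC2_F_sqr_cvg : imx_cvg_mul (@DC2_F R) DC2_F.
Proof. by move=> i j; apply/cvg_ex; eexists; exact: lt_cvg_fin. Qed.

Lemma DC2_F2E (alpha : R) :
  DC2_F2 alpha = lt_toeplitz (nth 0 [:: 1; - (1 + alpha); alpha]).
Proof.
apply/funext => i; apply/funext => j; rewrite /DC2_F2 /DC2_F lt_toeplitz_mul.
rewrite /lt_toeplitz; case: leqP => _; last by rewrite !mulr0 addr0.
case: (i - j)%N => [|[|[|n]]].
- by rewrite big_nat1 /=; ring.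
- by rewrite !big_nat_recr //= big_geq //= ; ring.
- by rewrite !big_nat_recr //= big_geq //= ; ring.
- rewrite big_nat_cond big1 /= ?nth_nil ?mulr0 ?addr0 //.
  move=> m _; have [m1|m1] := leqP 2 m; first by rewrite [X in _ * X]nth_default ?mulr0.
  by rewrite [X in X * _]nth_default ?mul0r //=; lia.
Qed.

Let g (alpha : R) n := \sum_(0 <= i < n.+1) alpha ^+ i.

Let conv_rec (alpha : R) d n :
  conv (nth 0 [:: 1; - (1 + alpha); alpha]) d n.+2 =
  d n.+2 - (1 + alpha) * d n.+1 + alpha * d n.
Proof.
rewrite /conv !big_nat_recr //= big_nat_cond big1 ?add0r.
  have [-> -> ->] : [/\ n.+2 - n.+2 = 0, n.+2 - n.+1 = 1 & n.+2 - n = 2]%N by split; lia.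
  by rewrite /=; ring.
move=> m /andP[/andP[_ mn] _].
by rewrite nth_default ?mul0r //=; lia.
Qed.

Let conv0 c d : conv c d 0 = c 0 * d 0.
Proof. by rewrite /conv big_nat1. Qed.

Let conv1 c d : conv c d 1 = c 1 * d 0 + c 0 * d 1.
Proof. by rewrite /conv !big_nat_recr //= big_geq // add0r. Qed.

Let conv_g (alpha : R) n :
  conv (nth 0 [:: 1; - (1 + alpha); alpha]) (g alpha) n = (n == 0%N)%:R.
Proof.
case: n => [|[|n]].
- by rewrite conv0 /g big_nat1 /= mulr1.
- by rewrite conv1 /g !big_nat_recr //= big_geq //=; ring.
- rewrite conv_rec /g [in X in X - _]big_nat_recr //= [in X in X - _]big_nat_recr //=.
  by rewrite [in X in _ - X]big_nat_recr //= !exprS; ring.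
Qed.

Let imx1E : imx1 = lt_toeplitz (fun n => (n == 0%N)%:R) :> imx R.
Proof.
apply/funext => i; apply/funext => j; rewrite /imx1 /imx_diag /lt_toeplitz.
case: ltngtP => // [ij|->]; last by rewrite subnn.
by have -> : (i - j == 0)%N = false by apply/eqP; lia.
Qed.

Let lt_toeplitz_inj c d : lt_toeplitz c = lt_toeplitz d -> c = d.
Proof.
move=> H; apply/funext => n; have := congr1 (fun A : imx R => A n 0%N) H.
by rewrite /lt_toeplitz leq0n subn0.
Qed.

Let g_inv (alpha : R) : is_lt_toeplitz_inv (DC2_F2 alpha) (lt_toeplitz (g alpha)).
Proof.
rewrite DC2_F2E; split; first by exists (g alpha).
- split; first by move=> i j; apply/cvg_ex; eexists; exact: lt_cvg_fin.
  by rewrite lt_toeplitz_mul imx1E; congr lt_toeplitz; apply/funext => n; exact: conv_g.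
- split; first by move=> i j; apply/cvg_ex; eexists; exact: lt_cvg_fin.
  rewrite lt_toeplitz_mul imx1E; congr lt_toeplitz; apply/funext => n.
  by rewrite -/(conv _ _ n) convC conv_g.
Qed.

Lemma is_lt_toeplitz_inv_DC2_F2 (alpha : R) A :
  is_lt_toeplitz_inv (DC2_F2 alpha) A ->
  A = lt_toeplitz (fun n => \sum_(0 <= i < n.+1) alpha ^+ i).
Proof.
move=> [[d ->] [_ + ] _]; rewrite DC2_F2E lt_toeplitz_mul imx1E => /lt_toeplitz_inj H.
have {}H n : conv (nth 0 [:: 1; - (1 + alpha); alpha]) d n = (n == 0%N)%:R.
  by rewrite -[RHS](congr1 (fun f => f n) H).
congr lt_toeplitz; apply/funext => n; rewrite -/(g alpha n).
have [//] : d n = g alpha n /\ d n.+1 = g alpha n.+1.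
elim: n => [|n [IH0 IH1]]; last split => //.
- have := H 0%N; have := conv_g alpha 0; rewrite !conv0 /= !mul1r => -> e0.
  split=> //; have := H 1%N; rewrite -(conv_g alpha 1) !conv1 /= !mul1r e0.
  have -> : g alpha 0 = 1 by rewrite /g big_nat1.
  by move/addrI.
- have := H n.+2; rewrite -(conv_g alpha n.+2) !conv_rec IH0 IH1.
  by move/addIr/addIr.
Qed.

Lemma DC2_F2inv_spec (alpha : R) :
  is_lt_toeplitz_inv (DC2_F2 alpha) (DC2_F2inv alpha).
Proof.
have : [set A | is_lt_toeplitz_inv (DC2_F2 alpha) A] !=set0.
  by exists (lt_toeplitz (g alpha)); exact: g_inv.
by case=> A hA; exact: (@getI _ _ A hA).
Qed.

Lemma DC2_F2invE (alpha : R) :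
  DC2_F2inv alpha = lt_toeplitz (fun n => \sum_(0 <= i < n.+1) alpha ^+ i).
Proof. exact/is_lt_toeplitz_inv_DC2_F2/DC2_F2inv_spec. Qed.

Let diag_cvg A d i j :
  (fun n => \sum_(0 <= k < n) A i k * imx_diag d k j) @ \oo --> A i j * d j.
Proof.
have := @cvg_fin A (imx_diag d) i j j.+1; rewrite big_nat_recr //= big_nat_cond.
rewrite big1 ?add0r.
  by rewrite /imx_diag eqxx; apply => k jk; rewrite gtn_eqF ?mulr0.
by move=> k /andP[/andP[_ kj] _]; rewrite /imx_diag ltn_eqF ?mulr0.
Qed.


Lemma DC2_kernel_cvg (alpha beta : R) : 0 < beta < 1 -> 0 <= alpha <= 1 ->
  imx_cvg_mul (imx_tr (DC2_F2inv alpha)) (DC2_Dinv beta) /\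
  imx_cvg_mul (imx_mul (imx_tr (DC2_F2inv alpha)) (DC2_Dinv beta))
              (DC2_F2inv alpha).
Proof.
move=> /andP[b0 b1] /andP[a0 a1]; split=> i j.
  by apply/cvg_ex; eexists; exact: diag_cvg.
have gB n m : (n <= m)%N -> 0 <= g alpha n <= m.+1%:R.
  move=> nm; apply/andP; split; first by apply: sumr_ge0 => k _; exact: exprn_ge0.
  rewrite (@le_trans _ _ (\sum_(0 <= k < n.+1) 1)) //.
    by apply: ler_sum => k _; exact: exprn_ile1.
  by rewrite sumr_const_nat subn0 ler_nat.
have GB k l : 0 <= DC2_F2inv alpha k l <= k.+1%:R.
  rewrite DC2_F2invE /lt_toeplitz; case: leqP => _; last by rewrite lexx ler0n.
  by apply: gB; exact: leq_subr.
pose q := Num.sqrt beta; pose r := Num.sqrt q.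
have q0 : 0 < q by rewrite sqrtr_gt0.
have r0 : 0 < r by rewrite sqrtr_gt0.
have q2 : q ^+ 2 = beta by rewrite sqr_sqrtr // ltW.
have r2 : r ^+ 2 = q by rewrite sqr_sqrtr // ltW.
have q1 : q < 1 by nra.
have r1 : r < 1 by nra.
pose C := (1 - r)^-1.
have C0 : 0 < C by rewrite invr_gt0 subr_gt0.
have rB n : n.+1%:R * r ^+ n <= C.
  have : \sum_(0 <= i < n.+1) r ^+ n <= \sum_(0 <= i < n.+1) r ^+ i.
    apply: ler_sum_nat => k /andP[_ kn].
    by apply: ler_wiXn2l; rewrite ?ltW.
  rewrite sumr_const_nat subn0 mulr_natl => /le_trans; apply.
  rewrite -[leRHS]mul1r ler_pdivlMr ?subr_gt0 // big_mkord.
  have := subrX1 r n.+1; have := exprn_gt0 n.+1 r0; lra.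
pose u n := imx_mul (imx_tr (DC2_F2inv alpha)) (DC2_Dinv beta) i n * DC2_F2inv alpha n j.
have uE n : u n = DC2_F2inv alpha n i * beta ^+ n.+1 * DC2_F2inv alpha n j.
  rewrite /u /imx_mul (cvg_lim _ (@diag_cvg _ _ _ _)) //.
  by rewrite /imx_tr /DC2_D /imx_diag eqxx invrK.
apply: (@series_le_cvg _ u (geometric (C ^+ 2) q)) => [n|n|n|].
- rewrite uE; have /andP[? _] := GB n i; have /andP[? _] := GB n j.
  by rewrite mulr_ge0 // mulr_ge0 // exprn_ge0 // ltW.
- by apply: mulr_ge0; apply: exprn_ge0; exact: ltW.
- rewrite uE /=.
  have /andP[x0 xn] := GB n i; have /andP[y0 yn] := GB n j.
  have bn : beta ^+ n.+1 <= r ^+ n * r ^+ n * q ^+ n.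
    rewrite -exprD addnn -mul2n exprM r2 -exprD addnn -mul2n exprM q2.
    by rewrite exprS ler_piMl ?exprn_ge0 // ltW.
  have p0 : 0 < beta ^+ n.+1 by exact: exprn_gt0.
  have qn0 : 0 < q ^+ n by exact: exprn_gt0.
  have rn0 : 0 < r ^+ n by exact: exprn_gt0.
  apply: (@le_trans _ _ (n.+1%:R * (r ^+ n * r ^+ n * q ^+ n) * n.+1%:R)).
    by rewrite ler_pM // ?ler_pM // ?mulr_ge0 // ltW.
  rewrite [leLHS](_ : _ = (n.+1%:R * r ^+ n) ^+ 2 * q ^+ n); last by ring.
  rewrite ler_pM2r //; apply: lerXn2r; rewrite ?nnegrE; last exact: rB.
    by rewrite mulr_ge0 // ltW.
  exact: ltW.
- by apply: is_cvg_geometric_series; rewrite ger0_norm // ltW.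
Qed.

End WellDefined.

(* Main.v *)
(* The kernel entries satisfy [K (i+1) (j+1) = beta K i j] and
   [K i j - (1 + alpha) K i (j+1) + alpha K i (j+2) = kappa g(j-i) beta^(j+1)],
   where [g] is the first column of the inverse of [F_{2,alpha}] (zero at negative
   arguments).  So if [L] is the claimed factor, [K L] is upper triangular with
   diagonal entries [1 / L_{jj}]; for all but the last two columns this is the
   recurrence itself, and those two only need the closed forms of [K j j] and
   [K j (j+1)], which the recurrence determines without summing any series.
   Then [L^T K L] is symmetric and upper unitriangular, hence the identity, which
   gives [K^-1 = L L^T] and [det K = prod_j L_{jj}^-2]; the Cholesky factor is
   unique. *)
Require Import Defs.
From mathcomp Require Import all_boot all_order all_algebra.
From mathcomp Require Import ring lra zify.
From mathcomp Require Import all_classical all_reals all_analysis.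
Import Order.TTheory GRing.Theory Num.Theory.
Import numFieldNormedType.Exports.
Local Open Scope ring_scope.

(** * Triangular matrices and uniqueness of the Cholesky factor *)

Section Triangular.
Context {R : realFieldType}.

Lemma mul_utriang_entry {n : nat} (A B : 'M[R]_n) :
  (forall i j : 'I_n, (j < i)%N -> A i j = 0) ->
  (forall i j : 'I_n, (j < i)%N -> B i j = 0) ->
  forall i j : 'I_n, (j <= i)%N ->
    (A *m B) i j = if i == j then A i i * B i i else 0.
Proof.
move=> hA hB i j ji; rewrite mxE; case: eqVneq => [<-|ij].
  rewrite (bigD1 i) //= big1 ?addr0 // => k ki.
  have [ik|ik|/val_inj e] := ltngtP k i.
  - by rewrite hA ?mul0r.
  - by rewrite hB ?mulr0.
  - by rewrite e eqxx in ki.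
rewrite big1 // => k _; have [ik|ik] := ltnP k i; first by rewrite hA ?mul0r.
rewrite hB ?mulr0 //; apply: leq_trans ik.
by rewrite ltn_neqAle ji andbT eq_sym.
Qed.

(** [L^T] and [K *m L] are both upper triangular, so on and below the diagonal their product is read
    off from the two diagonals; symmetry of [K] carries this above the diagonal. *)
Lemma congr_mx1_of_utriang {n : nat} (K L : 'M[R]_n) :
  K^T = K ->
  (forall i j : 'I_n, (i < j)%N -> L i j = 0) ->
  (forall i j : 'I_n, (j < i)%N -> (K *m L) i j = 0) ->
  (forall i : 'I_n, L i i * (K *m L) i i = 1) ->
  L^T *m K *m L = 1%:M.
Proof.
move=> Ks hL hU h1.
have low (i j : 'I_n) : (j <= i)%N -> (L^T *m K *m L) i j = (i == j)%:R.
  move=> ji; rewrite -mulmxA mul_utriang_entry //; last first.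
    by move=> a b ab; rewrite mxE hL.
  by case: eqVneq => // _; rewrite mxE h1.
have sym : (L^T *m K *m L)^T = L^T *m K *m L.
  by rewrite !trmx_mul trmxK Ks mulmxA.
apply/matrixP => i j; have -> : 1%:M i j = (i == j)%:R :> R by rewrite mxE.
have [ji|/ltnW ij] := leqP j i; first exact: low.
by rewrite eq_sym -low // -[in LHS]sym mxE.
Qed.

Lemma unitmx_congr_mx1 {n : nat} (K L : 'M[R]_n) :
  L^T *m K *m L = 1%:M -> K \in unitmx /\ invmx K = L *m L^T.
Proof.
move=> H; have [_ uL] := mulmx1_unit H.
(* A one-sided inverse of a square matrix is two-sided, so the factors of [L^T *m K *m L = 1] may be
   rotated cyclically. *)
have KLL : K *m (L *m L^T) = 1%:M.
  by apply: mulmx1C; rewrite -mulmxA; apply: mulmx1C.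
have [uK _] := mulmx1_unit KLL; split=> //.
by rewrite -[RHS](mulKmx uK) KLL mulmx1.
Qed.

Lemma det_congr_mx1 {n : nat} (K L : 'M[R]_n) :
  (forall i j : 'I_n, (i < j)%N -> L i j = 0) ->
  L^T *m K *m L = 1%:M -> \det K = \prod_(i < n) (L i i ^+ 2)^-1.
Proof.
move=> hL /(congr1 determinant); rewrite !det_mulmx det_tr det1 => H.
have dL : \det L = \prod_i L i i.
  by apply: det_trig; apply/is_trig_mxP => i j; exact: hL.
rewrite prodfV prodrXl -dL.
have : \det L != 0.
  by apply/eqP => L0; move: H; rewrite L0 mulr0 => /esym/eqP; rewrite oner_eq0.
move=> nz; apply: (mulIf (expf_neq0 2 nz)); rewrite mulVf ?expf_neq0 // -H.
by ring.
Qed.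

Lemma mul_tr_ltriang_entry {n : nat} (L : 'M[R]_n) :
  (forall i j : 'I_n, (i < j)%N -> L i j = 0) ->
  forall i j : 'I_n,
    (L *m L^T) i j = \sum_(k < n | (k < j)%N) L i k * L j k + L i j * L j j.
Proof.
move=> hL i j; rewrite mxE (bigID (fun k : 'I_n => (k < j)%N)) /=; congr (_ + _).
  by apply: eq_bigr => k _; rewrite mxE.
rewrite (bigD1 j) ?ltnn //= mxE big1 ?addr0 // => k /andP[].
rewrite -leqNgt leq_eqVlt => /orP[/eqP/val_inj->|jk _]; first by rewrite eqxx.
by rewrite mxE (hL j k) ?mulr0.
Qed.

(** Column by column: once the columns before [j] agree, so do the products [L i j * L j j]. The
    case [i = j] equates the positive diagonal entries, which then cancel. *)
Lemma cholesky_unique {n : nat} (L M : 'M[R]_n) :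
  (forall i j : 'I_n, (i < j)%N -> L i j = 0) -> (forall i, 0 < L i i) ->
  (forall i j : 'I_n, (i < j)%N -> M i j = 0) -> (forall i, 0 < M i i) ->
  L *m L^T = M *m M^T -> L = M.
Proof.
move=> hL pL hM pM E.
suff H m (j : 'I_n) : (j < m)%N -> forall i, L i j = M i j.
  by apply/matrixP => i j; exact: (H j.+1 j (ltnSn _)).
elim: m j => // m IH j; rewrite ltnS => jm.
have S i : L i j * L j j = M i j * M j j.
  have := congr1 (fun A : 'M[R]_n => A i j) E; rewrite /= !mul_tr_ltriang_entry //.
  have -> : \sum_(k < n | (k < j)%N) L i k * L j k =
            \sum_(k < n | (k < j)%N) M i k * M j k.
    by apply: eq_bigr => k kj; rewrite !IH // (leq_trans kj jm).
  by move/addrI.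
have jj : L j j = M j j.
  have := S j; rewrite -!expr2 => /eqP.
  by rewrite eqrXn2 // ?ltW // => /eqP.
by move=> i; have := S i; rewrite jj; apply: mulIf; rewrite gt_eqF.
Qed.

End Triangular.

(** * Auxiliary finite sums and products *)

Lemma sum_ord_support {V : nmodType} (a b m : nat) (F : nat -> V) :
  (a <= b)%N -> (b <= m)%N ->
  (forall k, (k < a)%N -> F k = 0) -> (forall k, (b <= k)%N -> F k = 0) ->
  \sum_(k < m) F k = \sum_(a <= k < b) F k.
Proof.
move=> ab bm Fa Fb; rewrite -(big_mkord xpredT F).
rewrite (@big_cat_nat _ _ _ b 0 m) //= (@big_cat_nat _ _ _ a 0 b) //=.
rewrite big_nat big1 ?add0r; last by move=> k /Fa.
by rewrite [X in _ + X]big_nat [X in _ + X]big1 ?addr0 // => k /andP[/Fb].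
Qed.

(** Recursion for the triangular numbers, which are the exponents of [beta] in the determinant. *)
Lemma triangleS m : (m.+1 * m.+2 %/ 2 = m.+1 + m * m.+1 %/ 2)%N.
Proof.
by rewrite (_ : m.+1 * m.+2 = m.+1 * 2 + m * m.+1)%N ?divnMDl //; lia.
Qed.

Lemma prod_geom {R : comNzRingType} (c q : R) (m : nat) :
  \prod_(i < m) (c * q ^+ i.+1) = c ^+ m * q ^+ (m * m.+1 %/ 2).
Proof.
elim: m => [|m IH]; first by rewrite big_ord0 !expr0 mulr1.
rewrite big_ord_recr /= IH triangleS exprD [c ^+ m.+1]exprSr.
by rewrite mulrACA [q ^+ m.+1 * _]mulrC.
Qed.

(** * Entries of the claimed factor *)

Section CholeskyEntries.
Context {R : realType}.
Variables (alpha beta : R) (n : nat).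

Local Notation kappa := (DC2_kappa alpha beta).
(** With [T = n + 2] and indices from 0, the two exceptional columns are [n] and [n.+1]. *)
Local Notation chol i j := (DC2_chol_entry alpha beta n.+2 (S i) (S j)).

Lemma DC2_chol_diag j : (j < n)%N ->
  chol j j = 1 / Num.sqrt (kappa * beta ^+ j.+1).
Proof. by move=> jn; rewrite /DC2_chol_entry ifT //; lia. Qed.

Lemma DC2_chol_subdiag j : (j < n)%N ->
  chol j.+1 j = - (1 + alpha) / Num.sqrt (kappa * beta ^+ j.+1).
Proof.
move=> jn; rewrite /DC2_chol_entry ifN; last by lia.
by rewrite ifT ?subn1 //; lia.
Qed.

Lemma DC2_chol_subsubdiag j : (j < n)%N ->
  chol j.+2 j = alpha / Num.sqrt (kappa * beta ^+ j.+1).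
Proof.
move=> jn; rewrite /DC2_chol_entry; do 2![rewrite ifN; last by lia].
by rewrite ifT ?subn2 //; lia.
Qed.

Lemma DC2_chol_penult : chol n n =
  Num.sqrt ((1 + alpha * beta) * beta ^- n.+1
            / ((1 - beta) * (1 - alpha ^+ 2 * beta))).
Proof.
rewrite /DC2_chol_entry; do 3![rewrite ifN; last by lia].
by rewrite ifT ?subn1 //; lia.
Qed.

Lemma DC2_chol_last_penult : chol n.+1 n =
  - (1 + alpha) * Num.sqrt (beta ^- n.+1)
  / Num.sqrt ((1 + alpha * beta) * (1 - beta) * (1 - alpha ^+ 2 * beta)).
Proof.
rewrite /DC2_chol_entry; do 4![rewrite ifN; last by lia].
by rewrite ifT ?subn1 //; lia.
Qed.

Lemma DC2_chol_last :
  chol n.+1 n.+1 = Num.sqrt (beta ^- n.+2 / (1 + alpha * beta)).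
Proof.
rewrite /DC2_chol_entry; do 5![rewrite ifN; last by lia].
by rewrite ifT //; lia.
Qed.

Lemma DC2_chol_upper i j : (i < j)%N -> chol i j = 0.
Proof. by move=> ij; rewrite /DC2_chol_entry; do 6![rewrite ifN; last by lia]. Qed.

Lemma DC2_chol_band i j : (j.+2 < i)%N -> chol i j = 0.
Proof. by move=> ij; rewrite /DC2_chol_entry; do 6![rewrite ifN; last by lia]. Qed.

Definition DC2_chol_mx : 'M[R]_n.+2 := \matrix_(i, j) chol i j.

Lemma DC2_chol_mx_trig (i j : 'I_n.+2) : (i < j)%N -> DC2_chol_mx i j = 0.
Proof. by move=> ij; rewrite mxE DC2_chol_upper. Qed.

End CholeskyEntries.

(** * Series and recurrences for the kernel entries *)

Section Kernel.
Local Open Scope classical_set_scope.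
Local Open Scope ring_scope.
Context {R : realType}.
Variables alpha beta : R.

Local Notation G := (DC2_F2inv alpha).

Definition DC2_kernel_term i j k : R := G k i * beta ^+ k.+1 * G k j.

(** [DC2_Dinv] is diagonal, so the partial sums are constant once they include index [k]. *)
Lemma DC2_kernel_factor_entry i k :
  imx_mul (imx_tr (DC2_F2inv alpha)) (DC2_Dinv beta) i k = G k i * beta ^+ k.+1.
Proof.
apply: cvg_lim => //; apply: cvg_near_cst; near=> n.
have kn : (k < n)%N by near: n; exists k.+1.
rewrite (@big_cat_nat _ _ _ k.+1 0 n) //= big_nat_recr //=.
rewrite big_nat_cond big1 ?add0r; last first.
  move=> l /andP[/andP[_ lk] _].
  by rewrite /DC2_Dinv /imx_diag ltn_eqF ?mulr0.
rewrite big_nat_cond big1 ?addr0; last first.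
  move=> l /andP[/andP[kl _] _].
  by rewrite /DC2_Dinv /imx_diag gtn_eqF ?mulr0.
by rewrite /DC2_Dinv /DC2_D /imx_diag eqxx invrK.
Unshelve. all: by end_near. Qed.

Lemma DC2_F2inv_shift k i : G k.+1 i.+1 = G k i.
Proof. by rewrite DC2_F2invE /lt_toeplitz ltnS subSS. Qed.

(** This is the product of the inverse with [DC2_F2] being the identity, written entrywise: column
    [j] of [DC2_F2] is supported on rows [j], [j.+1], [j.+2]. *)
Lemma DC2_F2inv_rec k j :
  G k j - (1 + alpha) * G k j.+1 + alpha * G k j.+2 = (k == j)%:R.
Proof.
rewrite DC2_F2invE /lt_toeplitz.
have [kj|] := ltnP k j.
  have -> : (j.+1 <= k)%N = false by lia.
  have -> : (j.+2 <= k)%N = false by lia.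
  by rewrite ltn_eqF // !mulr0 subr0 addr0.
move=> /subnKC <-; move: (k - j)%N => n.
case: n => [|[|n]].
- rewrite addn0 ltnn eqxx subnn leqNgt leqW //= big_nat1 expr0; ring.
- have -> : (j + 1 == j)%N = false by lia.
  have -> : (j.+1 <= j + 1)%N by lia.
  have -> : (j.+2 <= j + 1)%N = false by lia.
  have -> : (j + 1 - j = 1)%N by lia.
  have -> : (j + 1 - j.+1 = 0)%N by lia.
  by rewrite !big_nat_recr //= big_geq //=; ring.
- have -> : (j + n.+2 == j)%N = false by lia.
  have -> : (j.+1 <= j + n.+2)%N by lia.
  have -> : (j.+2 <= j + n.+2)%N by lia.
  have -> : (j + n.+2 - j = n.+2)%N by lia.
  have -> : (j + n.+2 - j.+1 = n.+1)%N by lia.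
  have -> : (j + n.+2 - j.+2 = n)%N by lia.
  rewrite [\sum_(0 <= i < n.+3) _]big_nat_recr //=.
  rewrite [\sum_(0 <= i < n.+2) _]big_nat_recr //= !exprS; ring.
Qed.

Hypothesis beta01 : 0 < beta < 1.
Hypothesis alpha01 : 0 <= alpha <= 1.

Local Notation kappa := (DC2_kappa alpha beta).
Local Notation K := (DC2_kernel alpha beta).

Definition DC2_kernel_psum i j n := kappa * \sum_(0 <= k < n) DC2_kernel_term i j k.

Lemma DC2_kernel_series_cvg i j : DC2_kernel_psum i j @ \oo --> K i j.
Proof.
apply: cvgMl_tmp; have [_ /(_ i j)] := DC2_kernel_cvg beta01 alpha01.
suff -> : (fun n => \sum_(0 <= k < n) DC2_kernel_term i j k) =
    (fun n => \sum_(0 <= k < n)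
       imx_mul (imx_tr (DC2_F2inv alpha)) (DC2_Dinv beta) i k
       * DC2_F2inv alpha k j) by [].
by apply/funext => n; apply: eq_bigr => k _; rewrite DC2_kernel_factor_entry.
Qed.

Lemma DC2_kernelE i j : K i j = limn (DC2_kernel_psum i j).
Proof. by rewrite (cvg_lim _ (DC2_kernel_series_cvg i j)). Qed.

Lemma DC2_kernelC i j : K i j = K j i.
Proof.
rewrite !DC2_kernelE; congr (limn _); apply/funext => n.
by congr (_ * _); apply: eq_bigr => k _; rewrite /DC2_kernel_term; ring.
Qed.

(** Since [G] is Toeplitz, term [k.+1] of the series at [(i.+1, j.+1)] is [beta] times term [k] at
    [(i, j)]; term 0 vanishes because [G] is lower triangular. *)
Lemma DC2_kernel_shift i j : K i.+1 j.+1 = beta * K i j.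
Proof.
have h := cvgMl_tmp (a := beta) (DC2_kernel_series_cvg i j).
rewrite DC2_kernelE; apply: cvg_lim => //; rewrite -cvg_shiftS.
rewrite (_ : [sequence _]_n = fun n => beta * DC2_kernel_psum i j n).
  exact: h.
apply/funext => n /=.
rewrite /DC2_kernel_psum big_nat_recl // /DC2_kernel_term.
rewrite {1}DC2_F2invE /lt_toeplitz /= !mul0r add0r.
rewrite [RHS]mulrCA; congr (_ * _); rewrite mulr_sumr.
by apply: eq_bigr => k _; rewrite !DC2_F2inv_shift exprS; ring.
Qed.

(** Applying [DC2_F2inv_rec] to the second factor of each term leaves only [k = j], so the combined
    partial sums are constant beyond [j]. *)
Lemma DC2_kernel_rec i j :
  K i j - (1 + alpha) * K i j.+1 + alpha * K i j.+2 =
  kappa * (G j i * beta ^+ j.+1).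
Proof.
have h := cvgD (cvgB (DC2_kernel_series_cvg i j)
  (cvgMl_tmp (a := 1 + alpha) (DC2_kernel_series_cvg i j.+1)))
  (cvgMl_tmp (a := alpha) (DC2_kernel_series_cvg i j.+2)).
rewrite -(cvg_lim _ (h _ _ _ _)) //; apply: cvg_lim => //.
apply: cvg_near_cst; near=> n => /=.
have jn : (j < n)%N by near: n; exists j.+1.
transitivity (kappa * \sum_(0 <= k < n) G k i * beta ^+ k.+1 * (k == j)%:R).
  rewrite !fctE /DC2_kernel_psum mulrCA [X in _ + X]mulrCA.
  rewrite -mulrBr -mulrDr; congr (_ * _).
  rewrite !mulr_sumr -sumrB -big_split /=.
  by apply: eq_bigr => k _; rewrite -DC2_F2inv_rec /DC2_kernel_term; ring.
congr (_ * _); rewrite big_mkord (bigD1 (Ordinal jn)) //= eqxx mulr1 big1 ?addr0 //.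
by move=> k kj; have /negbTE -> : (k != j :> nat) by []; rewrite mulr0.
Unshelve. all: by end_near. Qed.

Lemma DC2_kernel_rec0 i j : (j < i)%N ->
  K i j - (1 + alpha) * K i j.+1 + alpha * K i j.+2 = 0.
Proof.
move=> ji; rewrite DC2_kernel_rec DC2_F2invE /lt_toeplitz leqNgt ji.
by rewrite mul0r mulr0.
Qed.

Lemma DC2_kernel_rec_diag j :
  K j j - (1 + alpha) * K j j.+1 + alpha * K j j.+2 = kappa * beta ^+ j.+1.
Proof.
by rewrite DC2_kernel_rec DC2_F2invE /lt_toeplitz leqnn subnn big_nat1 mul1r.
Qed.

(** Follows from the chain [alpha ^+ 2 * beta <= alpha * beta <= beta < 1]. *)
Lemma DC2_factors_gt0 :
  [/\ 0 < beta, 0 < 1 - beta, 0 < 1 - alpha * beta,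
      0 < 1 - alpha ^+ 2 * beta & 0 < 1 + alpha * beta].
Proof.
case/andP: beta01 => b0 b1; case/andP: alpha01 => a0 a1.
have ab0 : 0 <= alpha * beta by rewrite mulr_ge0 // ltW.
have ab : alpha * beta <= beta by rewrite ger_pMl.
have aab : alpha ^+ 2 * beta <= alpha * beta by rewrite ler_pM2r //; nra.
split; lra.
Qed.

Lemma DC2_kappa_gt0 : 0 < kappa.
Proof. by have [_ B A C _] := DC2_factors_gt0; rewrite !mulr_gt0. Qed.

(* The recurrence at (0,0), (1,0), (2,0), with the shift relation, is a linear
   system of determinant [kappa] for the first three entries of a row. *)
Lemma DC2_kernel_00_01 :
  K 0%N 0%N = beta * (1 + alpha * beta) /\ K 0%N 1%N = beta ^+ 2 * (1 + alpha).
Proof.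
have [_ _ _ _ /lt0r_neq0 pab] := DC2_factors_gt0.
have := DC2_kernel_rec_diag 0; have := @DC2_kernel_rec0 1 0 isT.
have := @DC2_kernel_rec0 2 0 isT.
rewrite !DC2_kernel_shift (DC2_kernelC 1 0) (DC2_kernelC 2 0) expr1.
move: (K 0%N 0%N) (K 0%N 1%N) (K 0%N 2%N) => x y z h2 h1 h0.
have xE : x = beta * (1 + alpha * beta).
  apply: (mulfI (lt0r_neq0 DC2_kappa_gt0)); apply/eqP; rewrite -subr_eq0; apply/eqP.
  (* Elimination: subtracting [alpha] times [h2] from [h0] removes [z], and the multiple of [h1]
     removes [y]. The remaining coefficient of [x] is [kappa], as [(1 + alpha beta)^2 - beta (1 +
     alpha)^2 = (1 - beta)(1 - alpha^2 beta)]. *)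
  transitivity ((1 + alpha * beta) *
      ((x - (1 + alpha) * y + alpha * z - kappa * beta)
       - alpha * (z - (1 + alpha) * (beta * y) + alpha * (beta * (beta * x))))
    + (1 + alpha) * (1 - alpha * beta)
      * (y - (1 + alpha) * (beta * x) + alpha * (beta * y))).
    by rewrite /DC2_kappa; ring.
  by rewrite h0 h1 h2 subrr !(mulr0, subr0, addr0).
split=> //; apply: (mulfI pab); rewrite -[LHS]subr0 -h1 xE; ring.
Qed.

Lemma DC2_kernel_addn i j m : K (i + m)%N (j + m)%N = beta ^+ m * K i j.
Proof.
elim: m => [|m IH]; first by rewrite !addn0 expr0 mul1r.
by rewrite !addnS DC2_kernel_shift IH exprS mulrA.
Qed.

Lemma DC2_kernel_diag m : K m m = beta ^+ m.+1 * (1 + alpha * beta).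
Proof.
rewrite -[m]add0n DC2_kernel_addn (proj1 DC2_kernel_00_01) add0n exprSr.
by rewrite mulrA.
Qed.

Lemma DC2_kernel_superdiag m : K m m.+1 = beta ^+ m.+2 * (1 + alpha).
Proof.
have := DC2_kernel_addn 0 1 m; rewrite add0n add1n => ->.
by rewrite (proj2 DC2_kernel_00_01) mulrA -exprD addn2.
Qed.

(** * The product of the kernel with the claimed factor, and the determinant *)

Section CholeskyFactor.
Variable n : nat.

Local Notation chol i j := (DC2_chol_entry alpha beta n.+2 (S i) (S j)).
Local Notation mulKL i j := (\sum_(k < n.+2) K i k * chol k j).

(** A regular column of the factor is the corresponding column of [DC2_F2] divided by the square
    root, so the product reproduces the recurrence. *)
Lemma DC2_kernel_mul_chol i j : (j < n)%N ->
  mulKL i j = (K i j - (1 + alpha) * K i j.+1 + alpha * K i j.+2)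
              / Num.sqrt (kappa * beta ^+ j.+1).
Proof.
move=> jn; rewrite (@sum_ord_support _ j j.+3 _ (fun k => K i k * chol k j)).
- rewrite !big_nat_recr ?big_geq ?add0r //; try lia.
  by rewrite DC2_chol_diag // DC2_chol_subdiag // DC2_chol_subsubdiag //=; ring.
- by rewrite leqW ?leqW.
- by [].
- by move=> k kj; rewrite DC2_chol_upper ?mulr0.
- by move=> k kj; rewrite DC2_chol_band ?mulr0.
Qed.

Lemma DC2_kernel_mul_chol_penult i :
  mulKL i n = K i n * chol n n + K i n.+1 * chol n.+1 n.
Proof.
rewrite !big_ord_recr /= big1 ?add0r // => k _.
by rewrite DC2_chol_upper ?mulr0.
Qed.

Lemma DC2_kernel_mul_chol_last i : mulKL i n.+1 = K i n.+1 * chol n.+1 n.+1.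
Proof.
rewrite big_ord_recr /= big1 ?add0r // => k _.
by rewrite DC2_chol_upper ?mulr0.
Qed.

(** The ratio is [- K n n.+1 / K n.+1 n.+1], exactly what cancels entry [(n.+1, n)] of the
    product. *)
Lemma DC2_chol_last_penultE :
  chol n.+1 n = - (1 + alpha) / (1 + alpha * beta) * chol n n.
Proof.
have [b0 B _ C A] := DC2_factors_gt0.
rewrite DC2_chol_penult DC2_chol_last_penult.
set a := 1 + alpha * beta in A *; set b := 1 - beta in B *.
set c := 1 - alpha ^+ 2 * beta in C *; set e := beta ^- n.+1.
have e0 : 0 < e by rewrite invr_gt0 exprn_gt0.
(* Pulling out the square [a ^+ 2] leaves both entries with the same root
   [sqrt (e / (a * b * c))]. *)
have -> : a * e / (b * c) = a ^+ 2 * (e / (a * b * c)) by field; rewrite !lt0r_neq0.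
have abc0 : 0 < a * b * c by rewrite !mulr_gt0.
rewrite (sqrtrM _ (sqr_ge0 a)) sqrtr_sqr gtr0_norm // (sqrtrM _ (ltW e0)).
rewrite (sqrtrV (ltW abc0)).
have s0 : Num.sqrt (a * b * c) != 0 by rewrite lt0r_neq0 // sqrtr_gt0.
by field; rewrite s0 lt0r_neq0.
Qed.

Lemma DC2_kernel_mul_chol_lower i j : (j < i < n.+2)%N -> mulKL i j = 0.
Proof.
move=> /andP[ji iN]; have [jn|nj] := ltnP j n.
  by rewrite DC2_kernel_mul_chol // DC2_kernel_rec0 // mul0r.
have [-> ->] : j = n /\ i = n.+1 by lia.
rewrite DC2_kernel_mul_chol_penult DC2_chol_last_penultE (DC2_kernelC n.+1 n).
rewrite DC2_kernel_superdiag DC2_kernel_diag.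
have [_ _ _ _ /lt0r_neq0 A] := DC2_factors_gt0.
by field.
Qed.

Lemma DC2_chol_sqr j : (j < n)%N -> chol j j ^+ 2 = (kappa * beta ^+ j.+1)^-1.
Proof.
have [b0 _ _ _ _] := DC2_factors_gt0.
move=> jn; rewrite DC2_chol_diag // div1r exprVn sqr_sqrtr //.
by rewrite ltW // mulr_gt0 ?DC2_kappa_gt0 ?exprn_gt0.
Qed.

Lemma DC2_chol_penult_sqr : chol n n ^+ 2 =
  (1 + alpha * beta) * beta ^- n.+1 / ((1 - beta) * (1 - alpha ^+ 2 * beta)).
Proof.
have [b0 B _ C A] := DC2_factors_gt0.
by rewrite DC2_chol_penult sqr_sqrtr // ltW // divr_gt0 ?mulr_gt0 ?invr_gt0
  ?exprn_gt0.
Qed.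

Lemma DC2_chol_last_sqr : chol n.+1 n.+1 ^+ 2 = beta ^- n.+2 / (1 + alpha * beta).
Proof.
have [b0 B _ C A] := DC2_factors_gt0.
by rewrite DC2_chol_last sqr_sqrtr // ltW // divr_gt0 ?invr_gt0 ?exprn_gt0.
Qed.

Lemma DC2_chol_mul_diag j : (j < n.+2)%N -> chol j j * mulKL j j = 1.
Proof.
have [b0 B _ C A] := DC2_factors_gt0.
move=> jN; have [jn|nj] := ltnP j n.
  rewrite DC2_kernel_mul_chol // DC2_kernel_rec_diag mulrCA -[X in _ * (_ * X)]div1r.
  rewrite -(DC2_chol_diag alpha beta n j jn) -expr2 DC2_chol_sqr // mulfV //.
  by rewrite lt0r_neq0 // mulr_gt0 ?DC2_kappa_gt0 ?exprn_gt0.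
have bX m : beta ^+ m != 0 by rewrite expf_neq0 // lt0r_neq0.
have [-> | ->] : j = n \/ j = n.+1 by lia.
  (* Factoring out [chol n n ^+ 2] removes all roots; the bracket simplifies by the same identity
     that produced [kappa] in the linear system. *)
  rewrite DC2_kernel_mul_chol_penult DC2_chol_last_penultE.
  rewrite DC2_kernel_superdiag DC2_kernel_diag [LHS](_ : _ = chol n n ^+ 2 *
    (beta ^+ n.+1 * (1 + alpha * beta)
     - beta ^+ n.+2 * (1 + alpha) ^+ 2 / (1 + alpha * beta))).
    by rewrite DC2_chol_penult_sqr [beta ^+ n.+2]exprS; field; rewrite ?bX !lt0r_neq0.
  by field; rewrite lt0r_neq0.
rewrite DC2_kernel_mul_chol_last mulrCA -expr2 DC2_chol_last_sqr DC2_kernel_diag.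
by field; rewrite bX lt0r_neq0.
Qed.

(** Square roots give nonnegativity; [DC2_chol_mul_diag] excludes zero. *)
Lemma DC2_chol_diag_gt0 j : (j < n.+2)%N -> 0 < chol j j.
Proof.
have [b0 B _ C A] := DC2_factors_gt0.
move=> jN; rewrite lt_neqAle eq_sym; apply/andP; split.
  apply/eqP => c0; have /eqP := DC2_chol_mul_diag j jN.
  by rewrite c0 mul0r eq_sym oner_eq0.
have [jn|nj] := ltnP j n; first by rewrite DC2_chol_diag // divr_ge0 ?sqrtr_ge0.
have [-> | ->] : j = n \/ j = n.+1 by lia.
  by rewrite DC2_chol_penult sqrtr_ge0.
by rewrite DC2_chol_last sqrtr_ge0.
Qed.

Lemma DC2_chol_mx_diag_gt0 (i : 'I_n.+2) : 0 < DC2_chol_mx alpha beta n i i.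
Proof. by rewrite mxE DC2_chol_diag_gt0. Qed.

Lemma DC2_kernel_mx_congr :
  (DC2_chol_mx alpha beta n)^T *m DC2_kernel_mx alpha beta n.+2
    *m DC2_chol_mx alpha beta n = 1%:M.
Proof.
have KL i j :
    (DC2_kernel_mx alpha beta n.+2 *m DC2_chol_mx alpha beta n) i j = mulKL i j.
  by rewrite mxE; apply: eq_bigr => k _; rewrite !mxE.
apply: congr_mx1_of_utriang.
- by apply/matrixP => i j; rewrite !mxE DC2_kernelC.
- exact: DC2_chol_mx_trig.
- by move=> i j ji; rewrite KL DC2_kernel_mul_chol_lower // ji ltn_ord.
- by move=> i; rewrite KL mxE DC2_chol_mul_diag.
Qed.

Lemma det_DC2_kernel_mx : \det (DC2_kernel_mx alpha beta n.+2) =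
  beta ^+ (n.+2 * n.+3 %/ 2) * (1 - alpha * beta) ^+ n
  * (1 - beta) ^+ n.+1 * (1 - alpha ^+ 2 * beta) ^+ n.+1.
Proof.
have [b0 B _ C A] := DC2_factors_gt0.
rewrite (det_congr_mx1 _ _ (DC2_chol_mx_trig alpha beta n) DC2_kernel_mx_congr).
rewrite !big_ord_recr /= !mxE /= DC2_chol_penult_sqr DC2_chol_last_sqr.
under eq_bigr => i _ do rewrite mxE /= DC2_chol_sqr // invrK.
(* The regular columns contribute [kappa ^+ n] and a power of [beta]; the factors [1 + alpha * beta]
   of the last two columns cancel each other. *)
rewrite prod_geom !triangleS !exprD /DC2_kappa !exprMn !exprS.
have bX m : beta ^+ m != 0 by rewrite expf_neq0 // lt0r_neq0.
by field; rewrite bX !lt0r_neq0.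
Qed.

End CholeskyFactor.

End Kernel.

Theorem corollary6p2 (R : realType) (alpha beta : R) (T : nat) :
  0 < beta < 1 -> 0 <= alpha <= 1 -> (2 <= T)%N ->
  [/\ DC2_kernel_mx alpha beta T \in unitmx,
      exists L : 'M[R]_T, is_cholesky_factor (invmx (DC2_kernel_mx alpha beta T)) L,
      forall L : 'M[R]_T,
        is_cholesky_factor (invmx (DC2_kernel_mx alpha beta T)) L ->
        forall t s : 'I_T, L t s = DC2_chol_entry alpha beta T t.+1 s.+1 &
      \det (DC2_kernel_mx alpha beta T) =
        beta ^+ (T * (T + 1) %/ 2) * (1 - alpha * beta) ^+ (T - 2)
        * (1 - beta) ^+ (T - 1) * (1 - alpha ^+ 2 * beta) ^+ (T - 1)].
Proof.
move=> hb ha; case: T => [|[|n]] // _.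
have [uK iK] := unitmx_congr_mx1 _ _ (DC2_kernel_mx_congr alpha beta hb ha n).
have trig := @DC2_chol_mx_trig R alpha beta n.
have pos := DC2_chol_mx_diag_gt0 alpha beta hb ha n.
split=> //.
- by exists (DC2_chol_mx alpha beta n); rewrite iK.
(* Uniqueness identifies any factor with [DC2_chol_mx], whose entries are the claimed ones. *)
- move=> L [Ltrig Lpos]; rewrite iK => /esym E t s.
  by rewrite (cholesky_unique _ _ Ltrig Lpos trig pos E) mxE.
- by rewrite det_DC2_kernel_mx // addn1 subn1 subn2.
Qed.
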